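(* Let $i\in\{0,1,2\}$ and let $\theta_i=\pm\Delta_d^*(F_{x_i=0})\ne0$ for a suitable choice of sign depending only on $F$ and $i$. For every $v\in\mathbb{Z}^3$ of degree $dm+\ell$ there exists a $K$-linear map $$\phi_{v,i}\colon\mathcal{D}_{v,\ell}\to\mathcal{D}_{v+e_i,\ell+1}$$ such that $P_{v+e_i,\ell+1,i}\circ\phi_{v,i}=(v_i+1)\theta_i\cdot\mathrm{id}_{\mathcal{D}_{v,\ell}}$, and such that if $v_i+1\neq0$ in $R$ then $\phi_{v,i}(\mathcal{E}_{v,\ell})\subseteq\mathcal{E}_{v+e_i,\ell+1}$. The map $\phi_{v,i}$ may be represented by a $\binom{2d+1}{2}\times\binom{2d}{2}$ matrix whose entries are $R$-linear combinations of $1,v_0,v_1,v_2$ and $m$, i.e. values at $(v,m)$ of polynomials of degree at most $1$ in $R[v_0,v_1,v_2,m]$ (the polynomials themselves not depending on $v$ and $m$).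
   Context: $R$ is $\mathbb{Z}$ or $\mathbb{F}_p$ ($p$ prime), $K$ is its fraction field, $R[x]=R[x_0,x_1,x_2]$, $R[x^\pm]=R[x_0^{\pm1},x_1^{\pm1},x_2^{\pm1}]$; similarly over $K$. For $v\in\mathbb{Z}^3$, $x^v=x_0^{v_0}x_1^{v_1}x_2^{v_2}$ and $\deg v=v_0+v_1+v_2$; $G_v$ is the coefficient of $x^v$ in $G$; $e_0,e_1,e_2$ is the standard basis of $\mathbb{Z}^3$. Integers are regarded as elements of $R$ via $\mathbb{Z}\to R$. For $S\subseteq\mathbb{Z}^3$, $K[x^\pm]_S$ is the $K$-space of Laurent polynomials supported on $S$, and $G|_S=\sum_{v\in S}G_vx^v$. Let $D_\ell=\{w\in\mathbb{Z}_{\ge0}^3:\deg w=\ell\}$, $D(v,\ell)=\{v-w:w\in D_\ell\}$, $\mathcal{D}_{v,\ell}=K[x^\pm]_{D(v,\ell)}$ (with monomial basis $x^{v-u}$, indexed by $u\in D_\ell$). Standing assumptions: $d\geq 2$ is an integer, $m$ is a positive integer, $d(m+1)\neq0$ in $R$, $\ell=2d-2$, and $F\in R[x]$ is homogeneous of degree $d$ and nondegenerate, meaning that $x_0\frac{\partial F}{\partial x_0},x_1\frac{\partial F}{\partial x_1},x_2\frac{\partial F}{\partial x_2}$ have no common zero in $\mathbb{P}^2$ over an algebraic closure of $K$. For $\ell'\ge d$ and $v$ of degree $dm+\ell'$, $\mathcal{E}_{v,\ell'}$ is the $K$-subspace of all $G\in\mathcal{D}_{v,\ell'}$ satisfying $$(v_h-s_h)\sum_{t\in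 D_d}F_tG_{v-s-t}=(m+1)\sum_{t\in D_d}t_hF_tG_{v-s-t}\qquad\text{for all } s\in D_{\ell'-d},\ h=0,1,2.$$ For $w\in\mathbb{Z}^3$, $\ell'\geq1$, $k\in\{0,1,2\}$, $P_{w,\ell',k}\colon\mathcal{D}_{w,\ell'}\to\mathcal{D}_{w-e_k,\ell'-1}$ is the restriction map $G\mapsto G|_{D(w-e_k,\ell'-1)}$. With $\{i,j,k\}=\{0,1,2\}$, $F_{x_i=0}$ is the binary form of degree $d$ in $x_j,x_k$ obtained by setting $x_i=0$, and $\Delta_d^*(F_{x_i=0})=\pm F_{de_j}F_{de_k}\,\mathrm{disc}(F_{x_i=0,x_k=1})$, where $\mathrm{disc}$ is the usual discriminant of a polynomial of degree $d$ in $x_j$. (Nondegeneracy of $F$ implies this is nonzero.) *)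

(* Defs.v *)
From HB Require Import structures.
From mathcomp Require Import all_boot all_order all_algebra.
From mathcomp Require Import fraction finmap.
From mathcomp.multinomials Require Import -(notations) monalg.
From mathcomp.multinomials Require Import mpoly.

Set Implicit Arguments.
Unset Strict Implicit.
Unset Printing Implicit Defensive.

Import GRing.Theory.
Local Open Scope ring_scope.

Variant Z_or_Fp : idomainType -> Prop :=
| IsZ : Z_or_Fp int
| IsFp (p : nat) : prime p -> Z_or_Fp 'F_p.

Notation Z3 := 'rV[int]_3.

Definition e3 (k : 'I_3) : Z3 := delta_mx 0 k.

Definition zdeg (v : Z3) : int := \sum_(h < 3) v 0 h.

Definition zvec (u : 'X_{1..3}) : Z3 := \row_h (u h)%:Z.

(* [basis 3 l] consists of the nondecreasing l-tuples of indices; [s2m] turns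
   such a tuple into an exponent vector. *)
Definition Dexp (l : nat) : seq 'X_{1..3} :=
  [seq s2m t | t : l.-tuple 'I_3 <- enum (basis 3 l)].

Lemma mem_Dexp l u : (u \in Dexp l) = (mdeg u == l).
Proof. by rewrite basis_cover. Qed.

Lemma uniq_Dexp l : uniq (Dexp l).
Proof.
rewrite map_inj_in_uniq ?enum_uniq // => s t; rewrite !mem_enum => hs ht.
exact: inj_s2m.
Qed.

Lemma size_Dexp l : size (Dexp l) = 'C(l.+2, 2).
Proof. by rewrite size_basis addn2 -[RHS]bin_sub // subn2. Qed.

Definition Dpts (v : Z3) (l : nat) : seq Z3 := [seq v - zvec u | u <- Dexp l].

Section Laurent.
Context (K : fieldType).

(* Laurent polynomials as a K-space only: the group algebra of Z^3 is not
   available as a ring in [monalg], and their product is not needed. *)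
Definition laurent := monalg.malg Z3 K.
HB.instance Definition _ := GRing.Lmodule.on laurent.

Definition lcoef (G : laurent) (v : Z3) : K := monalg.mcoeff v G.

Definition lmon (v : Z3) : laurent := monalg.mkmalgU v 1.

Definition restrict (S : seq Z3) (G : laurent) : laurent :=
  \sum_(v <- S) lcoef G v *: lmon v.

Definition supported_pred (S : seq Z3) : {pred laurent} :=
  fun G => all (mem S) (monalg.msupp G).
Arguments supported_pred _ _ /.
Definition supported (S : seq Z3) := [qualify a G | supported_pred S G].

Lemma supportedP S (G : laurent) :
  reflect (forall v, v \notin S -> lcoef G v = 0) (G \is a supported S).
Proof.
apply: (iffP allP) => [h v vS | h v]; last first.
  rewrite -monalg.mcoeff_neq0; apply: contraNT => /= vS.
  by apply/eqP/h.
by apply/eqP; rewrite [_ == _]monalg.mcoeff_eq0; apply: contra vS => /h.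
Qed.

Fact supported_submod S : submod_closed (supported S).
Proof.
split=> [|a G H /supportedP hG /supportedP hH]; apply/supportedP => v vS.
  exact: monalg.mcoeff0.
rewrite /lcoef monalg.mcoeffD monalg.mcoeffZ.
by move: (hG v vS) (hH v vS); rewrite /lcoef => -> ->; rewrite mulr0 addr0.
Qed.
HB.instance Definition _ S :=
  GRing.isSubmodClosed.Build K laurent (supported_pred S) (supported_submod S).

Record laurent_on (S : seq Z3) :=
  LaurentOn { lval : laurent; _ : lval \is a supported S }.
HB.instance Definition _ S := [isSub for @lval S].
HB.instance Definition _ S := [Choice of laurent_on S by <:].
HB.instance Definition _ S := [SubChoice_isSubLmodule of laurent_on S by <:].

Local Notation Dspace v l := (laurent_on (Dpts v l)).

Lemma lmon_supported (S : seq Z3) (v : Z3) :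
  v \in S -> lmon v \is a supported S.
Proof.
move=> vS; apply/supportedP => z zS; rewrite /lcoef /lmon monalg.mcoeffU.
by case: eqP => // vz; rewrite -vz vS in zS.
Qed.

Lemma restrict_supported (S : seq Z3) (G : laurent) :
  restrict S G \is a supported S.
Proof.
rewrite /restrict big_seq; apply: rpred_sum => v vS.
exact/rpredZ/lmon_supported.
Qed.

Definition Pmap (w : Z3) (l : nat) (k : 'I_3) (G : Dspace w l) :
    Dspace (w - e3 k) l.-1 :=
  LaurentOn (restrict_supported (Dpts (w - e3 k) l.-1) (lval G)).

(* For a polynomial of degree d whose coefficient of degree d and whose formal
   derivative's coefficient of degree d - 1 are nonzero, so that [resultant],
   which uses the actual sizes, is the determinant of the
   (2d - 1) x (2d - 1) Sylvester matrix. *)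
Definition disc (f : {poly K}) : K :=
  let d := (size f).-1 in
  (-1) ^+ (d * d.-1)./2 * resultant f f^`() / lead_coef f.

End Laurent.

Notation Dspace K v l := (laurent_on K (Dpts v l)).

Section Forms.
Context (R : idomainType).
Local Notation K := {fraction R}.
Local Notation "x %:F" := (@FracField.tofrac R x).
Implicit Types (F : {mpoly R[3]}) (d m : nat) (i j k : 'I_3).

Definition nondegenerate_form
    (L : closedFieldType) (iota : {rmorphism K -> L}) F : Prop :=
  ~ exists2 y : 'I_3 -> L, (exists h, y h != 0) &
      forall h, mmap (iota \o @FracField.tofrac R) y ('X_h * F^`M(h)) = 0.

(* F_{x_i = 0, x_k = 1} as a polynomial in the remaining variable. *)
Definition dehom F i k : {poly K} :=
  mmap (@polyC K \o @FracField.tofrac R)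
       (fun h => if h == i then 0 else if h == k then 1 else 'X) F.

Definition Delta_star F d i j k : K :=
  (F@_(U_(j) *+ d)%MM)%:F * (F@_(U_(k) *+ d)%MM)%:F * disc (dehom F i k).

Definition in_Espace F d m (v : Z3) (l : nat) (G : Dspace K v l) : Prop :=
  forall (s : 'X_{1..3}) (h : 'I_3), mdeg s = (l - d)%N ->
    (v 0 h - (s h)%:Z)%:~R *
      (\sum_(t <- Dexp d) (F@_t)%:F * lcoef (lval G) (v - zvec s - zvec t)) =
    (m + 1)%:R *
      (\sum_(t <- Dexp d)
         (t h)%:R * (F@_t)%:F * lcoef (lval G) (v - zvec s - zvec t)) :> K.

(* The point (v_0, v_1, v_2, m) at which the matrix entries are evaluated. *)
Definition vmpt (v : Z3) m : 'I_4 -> R :=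
  fun q => if unlift ord_max q is Some h then (v 0 h)%:~R else m%:R.

(* The matrix A represents phi in the monomial bases x^(v - u), u in D_l, and
   x^(v' - u'), u' in D_l', both enumerated by [Dexp]: column c lists the
   coefficients of the image of the c-th basis element. *)
Definition represents (v v' : Z3) (l l' a b : nat)
    (phi : Dspace K v l -> Dspace K v' l') (A : 'M[R]_(a, b)) : Prop :=
  forall (r : 'I_a) (c : 'I_b) (G : Dspace K v l),
    lval G = lmon K (v - zvec (nth 0%MM (Dexp l) c)) ->
    lcoef (lval (phi G)) (v' - zvec (nth 0%MM (Dexp l') r)) = (A r c)%:F.

End Forms.

(* Main.v *)
(* Enlarging D(v, l) to D(v + e_i, l + 1) adds the 2d monomials x^(v + e_i - w)
   with w_i = 0, and enlarging the system defining E adds the equations at the d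
   exponents s with s_i = 0; the three equations at such an s have a trivial sum
   by the degree condition on v.  Multiplying the equation h = j by v_i + 1,
   subtracting a multiple of the equation h = i and dividing by m + 1 leaves,
   for v_i + 1 times the new coefficients, a 2d x 2d system whose matrix S
   consists of the multiples of f = F_{x_i=0} and x_j df/dx_j by the monomials of
   degree d - 1, and whose right hand side is affine in (v, m).  Expanding det S
   along its first column gives F_{d e_k} Res(f, f') = +- Delta_d^*(f), so with
   theta = det S the map phi multiplies the old coefficients by
   (v_i + 1) theta and takes adj(S) times the right hand side as new ones.  A
   zero of F_{d e_j}, F_{d e_k} or disc f would yield, by Euler's identity and
   d <> 0, a common zero of the x_h dF/dx_h on the line x_i = 0. *)
Require Import Defs.
From HB Require Import structures.
From mathcomp Require Import all_boot all_order all_algebra.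
From mathcomp Require Import fraction finmap.
From mathcomp.multinomials Require Import mpoly.
From mathcomp Require Import ring zify.

Set Implicit Arguments.
Unset Strict Implicit.
Unset Printing Implicit Defensive.

Import GRing.Theory.
Local Open Scope ring_scope.

(** * Exponents in three indices and those on the face where the i-th entry vanishes *)

Section ThreeIndices.
Variables (i j k : 'I_3).
Hypothesis Hijk : uniq [:: i; j; k].

Lemma big_ord3_uniq (A : Type) (x : A) (op : Monoid.com_law x) (f : 'I_3 -> A) :
  \big[op/x]_(h < 3) f h = op (f i) (op (f j) (f k)).
Proof.
have -> : \big[op/x]_(h < 3) f h = \big[op/x]_(h <- [:: i; j; k]) f h.
  apply: perm_big; apply: uniq_perm; rewrite ?index_enum_uniq // => h.
  rewrite mem_index_enum; apply/esym.
  have /subset_cardP/(_ (subset_predT _)) : #|[:: i; j; k]| = #|'I_3|.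
    by rewrite (card_uniqP Hijk) card_ord.
  by move=> /(_ h).
by rewrite !big_cons big_nil Monoid.mulm1.
Qed.

Lemma ord3_cases (P : 'I_3 -> Prop) : P i -> P j -> P k -> forall h, P h.
Proof.
move=> Pi Pj Pk h.
have : h \in [:: i; j; k].
  have /subset_cardP/(_ (subset_predT _)) : #|[:: i; j; k]| = #|'I_3|.
    by rewrite (card_uniqP Hijk) card_ord.
  by move=> ->.
by rewrite !inE => /or3P[] /eqP->.
Qed.

Lemma mdeg3 (u : 'X_{1..3}) : mdeg u = (u i + (u j + u k))%N.
Proof. by rewrite mdegE big_ord3_uniq. Qed.

Lemma mnm3P (u w : 'X_{1..3}) : u i = w i -> u j = w j -> u k = w k -> u = w.
Proof. by move=> hi hj hk; apply/mnmP; apply: ord3_cases. Qed.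

Definition edge_mnm (n p : nat) : 'X_{1..3} := (U_(j) *+ n + U_(k) *+ p)%MM.

Lemma edge_mnmE n p :
  [/\ edge_mnm n p i = 0, edge_mnm n p j = n & edge_mnm n p k = p]%N.
Proof.
have := Hijk; rewrite /= !inE !negb_or andbT -andbA => /and3P[ij ik jk].
rewrite !mnmDE !mulmnE !mnm1E !eqxx (eq_sym k) (eq_sym k) (eq_sym j).
by rewrite (negbTE ij) (negbTE ik) (negbTE jk) !mul0n !mul1n !addn0.
Qed.

Lemma mdeg_edge n p : mdeg (edge_mnm n p) = (n + p)%N.
Proof. by rewrite mdeg3; have [-> -> ->] := edge_mnmE n p. Qed.

(** An exponent of degree [d] with [t i = 0] is determined by its j-th entry, which runs from 0 to
    [d]. *)
Lemma sum_Dexp_edge (A : nmodType) d (f : 'X_{1..3} -> A) :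
  \sum_(t <- Dexp d | t i == 0%N) f t = \sum_(n < d.+1) f (edge_mnm n (d - n)).
Proof.
rewrite -(big_mkord predT (fun n => f (edge_mnm n (d - n)))) -[LHS]big_filter.
rewrite -[RHS](big_map (fun n => edge_mnm n (d - n)) predT f).
apply: perm_big; apply: uniq_perm; rewrite ?filter_uniq ?uniq_Dexp //.
  rewrite map_inj_in_uniq ?iota_uniq // => n p _ _ /= /(congr1 (fun u : 'X_{1..3} => u j)).
  by have [_ -> _] := edge_mnmE n (d - n); have [_ -> _] := edge_mnmE p (d - p).
move=> t; rewrite mem_filter mem_Dexp; apply/andP/mapP.
  case=> /eqP ti /eqP dt; have := mdeg3 t; rewrite dt ti => dE.
  exists (t j); first by rewrite mem_index_iota; lia.
  have [ei ej ek] := edge_mnmE (t j) (d - t j).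
  apply: mnm3P; rewrite ?ei ?ej ?ek //; lia.
case=> n; rewrite mem_index_iota => nd ->.
by rewrite mdeg_edge; have [-> _ _] := edge_mnmE n (d - n); split=> //; lia.
Qed.

End ThreeIndices.

(** * Restriction of F and its Euler derivatives x_h dF/dx_h to the line x_i = 0 *)

Lemma homog_sum (R : nzRingType) (d : nat) (F : {mpoly R[3]}) :
  F \is d.-homog -> F = \sum_(t <- Dexp d) F@_t *: 'X_[t].
Proof.
move=> hF; apply/mpolyP => u; rewrite raddf_sum /=.
under eq_bigr do rewrite mcoeffZ mcoeffX.
have [ud|ud] := boolP (u \in Dexp d).
  rewrite (bigD1_seq u) ?uniq_Dexp //= eqxx mulr1 big1 ?addr0 // => t /negbTE->.
  by rewrite mulr0.
rewrite (dhomog_nemf_coeff hF) -?mem_Dexp // big_seq big1 // => t td.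
by case: eqP => [tu|]; [rewrite -tu td in ud | rewrite mulr0].
Qed.

Section EdgePoly.
Variables (i j k : 'I_3).
Hypothesis Hijk : uniq [:: i; j; k].
Variables (R : comNzRingType) (d : nat) (F : {mpoly R[3]}).
Hypothesis HF : F \is d.-homog.
Local Notation mon n := (edge_mnm j k n (d - n)).

(** F_{x_i=0, x_k=1} as a polynomial in x_j, kept over [R] so that the Sylvester determinant and
    adjugate have values in [R]. *)
Definition edge_poly : {poly R} := \poly_(n < d.+1) F@_(mon n).

Lemma mmap1_edge (S : comNzRingType) (y : 'I_3 -> S) t :
  mmap1 y t = y i ^+ t i * (y j ^+ t j * y k ^+ t k).
Proof. by rewrite /mmap1 (big_ord3_uniq Hijk). Qed.

Lemma mmap_edge (S : comNzRingType) (f : {rmorphism R -> S}) (y : 'I_3 -> S) :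
  y i = 0 ->
  mmap f y F = \sum_(n < d.+1) f (F@_(mon n)) * (y j ^+ n * y k ^+ (d - n)).
Proof.
move=> yi; rewrite {1}(homog_sum HF) raddf_sum /= (bigID (fun t : 'X_{1..3} => t i == 0%N)) /=.
rewrite [X in _ + X]big1 ?addr0 => [|t ti]; last first.
  by rewrite mmapZ mmapX mmap1_edge yi expr0n (negbTE ti) !(mul0r, mulr0).
rewrite (sum_Dexp_edge Hijk); apply: eq_bigr => n _.
rewrite mmapZ mmapX mmap1_edge; have [-> -> ->] := edge_mnmE Hijk n (d - n).
by rewrite expr0 mul1r.
Qed.

(** The operator x_h d/dx_h multiplies the monomial of exponent t by t_h, and monomials with t_i <>
    0 vanish on the line. *)
Lemma mmap_euler_edge (S : comNzRingType) (f : {rmorphism R -> S})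
    (y : 'I_3 -> S) (h : 'I_3) :
  y i = 0 ->
  mmap f y ('X_h * F^`M(h)) =
    \sum_(n < d.+1) (mon n h)%:R * f (F@_(mon n)) * (y j ^+ n * y k ^+ (d - n)).
Proof.
move=> yi.
have term t : mmap f y ('X_h * (F@_t *: 'X_[t])^`M(h)) =
              (t h)%:R * f F@_t * mmap1 y t.
  rewrite mderivZ mderivX -scalerAr mmapZ -scalerAr mmapZ rmorph_nat.
  rewrite mulrA [f _ * _]mulrC; have [->|th] := eqVneq (t h) 0%N.
    by rewrite !mul0r.
  by rewrite -mpolyXD mmapX addmC submK // lep1mP.
rewrite {1}(homog_sum HF) raddf_sum mulr_sumr raddf_sum /=.
rewrite (bigID (fun t : 'X_{1..3} => t i == 0%N)) /=.
rewrite [X in _ + X]big1 ?addr0 => [|t ti]; last first.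
  by rewrite term mmap1_edge yi expr0n (negbTE ti) !(mul0r, mulr0).
rewrite (sum_Dexp_edge Hijk); apply: eq_bigr => n _.
rewrite term mmap1_edge; have [-> -> ->] := edge_mnmE Hijk n (d - n).
by rewrite expr0 mul1r.
Qed.

End EdgePoly.

(** * The Sylvester determinant in terms of the resultant of p and its derivative *)

(* The Sylvester matrix of the binary forms of degree [d] that dehomogenize to
   [p] and ['X * p^`()], with coefficients in increasing degree. *)
Definition euler_sylvester (R : nzRingType) (d : nat) (p : {poly R}) : 'M[R]_(2 * d) :=
  \matrix_(r, c) (if (r < d)%N then p * 'X^r else 'X * p^`() * 'X^(r - d))`_c.

Lemma det_matrix_cast (R : comNzRingType) (n n' : nat) (g : nat -> nat -> R) :
  n = n' -> \det (\matrix_(r < n, c < n) g r c) = \det (\matrix_(r < n', c < n') g r c).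
Proof. by move=> ->. Qed.

(** The first column holds constant terms, and every row but that of [p] itself is divisible by X.
    Deleting that row and column, which divides the other rows by X, leaves the Sylvester matrix of
    [p] and its derivative. *)
Lemma det_euler_sylvester (R : comNzRingType) (d : nat) (p : {poly R}) :
  (0 < d)%N -> size p = d.+1 -> size p^`() = d ->
  \det (euler_sylvester d p) = p`_0 * resultant p p^`().
Proof.
case: d => // d _ sp sp'.
pose g r c := (if (r < d.+1)%N then p * 'X^r else 'X * p^`() * 'X^(r - d.+1))`_c.
(* The degree of [p] is now d + 1, so the resultant has [d] rows from [p] and d + 1 rows from its
   derivative. *)
pose h r c := (if (r < d)%N then p * 'X^r else p^`() * 'X^(r - d))`_c.
have -> : \det (euler_sylvester d.+1 p) =
          \det (\matrix_(r < (d + d.+1).+1, c < (d + d.+1).+1) g r c).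
  by apply: (det_matrix_cast g); lia.
have -> : resultant p p^`() = \det (\matrix_(r < d + d.+1, c < d + d.+1) h r c).
  rewrite -(@det_matrix_cast _ ((size p^`()).-1 + (size p).-1) (d + d.+1) h); last first.
    by rewrite sp sp'.
  rewrite /resultant; congr (\det _); apply/matrixP => r c.
  rewrite Sylvester_mxE mxE /h; case: split_ordP => r' -> /=.
    have -> : (r' < d)%N by apply: leq_trans (ltn_ord r') _; rewrite sp'.
    rewrite coefMXn.
    by case: leqP; rewrite ?mulr1n ?mulr0n.
  move: (nat_of_ord c) (nat_of_ord r') => nc nr; rewrite sp' /=.
  rewrite [(_ + _ < d)%N]ltnNge leq_addr /= addKn coefMXn.
  by case: leqP; rewrite ?mulr1n ?mulr0n.
rewrite (expand_det_col _ ord0) (bigD1 ord0) //= big1 ?addr0 => [|r r0].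
  rewrite mxE /g /= expr0 mulr1 /cofactor addn0 expr0 mul1r; congr (_ * \det _).
  apply/matrixP => r c; rewrite !mxE /g /h /= /bump /= !add1n ltnS.
  case: ifP => rd; first by rewrite exprSr mulrA coefMX.
  by rewrite subSS -mulrA coefXM.
rewrite mxE /g; have r_gt0 : (0 < r)%N by rewrite lt0n.
case: ifP => rd; rewrite coefMXn; first by rewrite r_gt0 mul0r.
by case: ifP => _; rewrite ?coefXM !mul0r.
Qed.

Lemma map_euler_sylvester (R S : nzRingType) (f : {rmorphism R -> S}) (d : nat)
    (p : {poly R}) :
  map_mx f (euler_sylvester d p) = euler_sylvester d (map_poly f p).
Proof.
apply/matrixP => r c; rewrite !mxE.
case: ifP => _; rewrite -coef_map /= !rmorphM /= map_polyXn //.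
by rewrite map_polyX deriv_map.
Qed.

(** * Nonvanishing of the discriminant and the sign of theta *)

Section Discriminant.
Variables (R : idomainType) (L : closedFieldType).
Variable iota : {rmorphism {fraction R} -> L}.
Variables (d : nat) (F : {mpoly R[3]}) (i j k : 'I_3).
Hypothesis d_gt0 : (0 < d)%N.
Hypothesis dR : d%:R != 0 :> R.
Hypothesis HF : F \is d.-homog.
Hypothesis HFn : nondegenerate_form iota F.
Hypothesis Hijk : uniq [:: i; j; k].
Local Notation mon n := (edge_mnm j k n (d - n)).
Local Notation tofrac := (@FracField.tofrac R).
Local Notation p := (edge_poly j k d F).

Let iotaR : {rmorphism R -> L} := iota \o tofrac.

Let iotaR_eq0 x : (iotaR x == 0) = (x == 0).
Proof. by rewrite /= fmorph_eq0 tofrac_eq0. Qed.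

Let tofrac_inj : injective tofrac.
Proof. by move=> x y /eqP; rewrite tofrac_eq => /eqP. Qed.

Lemma coef_edge_poly n : (n <= d)%N -> p`_n = F@_(mon n).
Proof. by move=> nd; rewrite coef_poly ltnS nd. Qed.

(** The sums are the values of x_h dF/dx_h at the point with coordinates 0, [a], [b] in positions
    [i], [j], [k]. *)
Lemma nondegenerate_edge (a b : L) : (a != 0) || (b != 0) ->
  ~ forall h, \sum_(n < d.+1)
       (mon n h)%:R * iotaR (F@_(mon n)) * (a ^+ n * b ^+ (d - n)) = 0.
Proof.
move=> ab0 h0; apply: HFn.
have := Hijk; rewrite /= !inE !negb_or andbT -andbA => /and3P[ij ik jk].
pose y h : L := if h == j then a else if h == k then b else 0.
have yi : y i = 0 by rewrite /y (negbTE ij) (negbTE ik).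
have yj : y j = a by rewrite /y eqxx.
have yk : y k = b by rewrite /y eq_sym (negbTE jk) eqxx.
exists y => [|h].
  by case/orP: ab0 => ?; [exists j; rewrite yj | exists k; rewrite yk].
have := mmap_euler_edge Hijk HF iotaR h yi.
by rewrite yj yk h0.
Qed.

(** At the point with x_j = 1 and the other coordinates 0 only the monomial x_j^d survives, so if
    its coefficient were 0, all three Euler derivatives would vanish. *)
Lemma edge_poly_top_neq0 : p`_d != 0.
Proof.
apply/eqP => pd0; apply: (@nondegenerate_edge 1 0); first by rewrite oner_neq0.
move=> h; apply: big1 => n _; rewrite expr0n.
have [nd|] := eqVneq (d - n)%N 0%N; last by rewrite !mulr0.
have -> : n = d :> nat by have := ltn_ord n; lia.
by rewrite -coef_edge_poly // pd0 rmorph0 mulr0 mul0r.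
Qed.

Lemma edge_poly_bot_neq0 : p`_0 != 0.
Proof.
apply/eqP => p00; apply: (@nondegenerate_edge 0 1).
  by rewrite oner_neq0 orbT.
move=> h; apply: big1 => n _; rewrite expr0n.
have [->|] := eqVneq (n : nat) 0%N; last by rewrite mul0r mulr0.
by rewrite -coef_edge_poly // p00 rmorph0 mulr0 mul0r.
Qed.

Lemma size_edge_poly : size p = d.+1.
Proof.
apply/eqP; rewrite eqn_leq size_poly /= ltnNge; apply/negP => /leq_sizeP/(_ d).
by move=> /(_ (leqnn _)) pd; have := edge_poly_top_neq0; rewrite pd eqxx.
Qed.

(** The coefficient of degree d - 1 of the derivative is d F_{d e_j}, and [d] is nonzero in [R]. *)
Lemma size_deriv_edge_poly : size p^`() = d.
Proof.
have p0 : p != 0 by rewrite -size_poly_eq0 size_edge_poly.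
apply/eqP; rewrite eqn_leq -ltnS -size_edge_poly lt_size_deriv //=.
rewrite -(prednK d_gt0) ltnNge; apply/negP => /leq_sizeP/(_ _ (leqnn _)).
rewrite coef_deriv prednK // -mulr_natr => /eqP.
by rewrite mulf_eq0 (negbTE dR) orbF (negbTE edge_poly_top_neq0).
Qed.

(** With q the image of [p] over [L], the Euler derivatives at x_i = 0, x_j = a, x_k = 1 are 0, a
    q'(a) and, by Euler's identity, d q(a) - a q'(a). *)
Lemma edge_poly_no_double_root (a : L) :
  root (map_poly iotaR p) a -> root (map_poly iotaR p)^`() a -> False.
Proof.
set q := map_poly _ _ => /eqP qa /eqP q'a.
have sq : (size q <= d.+1)%N by rewrite -size_edge_poly size_poly.
have s1 : \sum_(n < d.+1) iotaR (F@_(mon n)) * a ^+ n = 0.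
  rewrite -[RHS]qa (horner_coef_wide _ sq); apply: eq_bigr => n _.
  by rewrite coef_map coef_edge_poly // -ltnS.
have s2 : \sum_(n < d.+1) (n%:R : L) * iotaR (F@_(mon n)) * a ^+ n = 0.
  have s : (size ('X * q^`())%R <= d.+1)%N.
    have [->|q'0] := eqVneq q^`() 0; first by rewrite mulr0 size_poly0.
    rewrite mulrC size_mulX // ltnS.
    by apply: leq_trans (lt_size_deriv _) sq; apply: contraNneq q'0 => ->; rewrite derivC.
  have := horner_coef_wide a s; rewrite hornerM q'a mulr0 => e; rewrite [RHS]e.
  apply: eq_bigr => n _; congr (_ * _); rewrite coefXM.
  case: n => -[|n] nd /=; first by rewrite mul0r.
  by rewrite coef_deriv coef_map coef_edge_poly // mulr_natl.
apply: (@nondegenerate_edge a 1); first by rewrite oner_neq0 orbT.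
apply: (ord3_cases Hijk).
- by apply: big1 => n _; have [-> _ _] := edge_mnmE Hijk n (d - n); rewrite !mul0r.
- rewrite -[RHS]s2; apply: eq_bigr => n _; have [_ -> _] := edge_mnmE Hijk n (d - n).
  by rewrite expr1n mulr1.
- transitivity (d%:R * \sum_(n < d.+1) iotaR (F@_(mon n)) * a ^+ n -
                \sum_(n < d.+1) (n%:R : L) * iotaR (F@_(mon n)) * a ^+ n).
    rewrite mulr_sumr -sumrB; apply: eq_bigr => n _.
    have [_ _ ->] := edge_mnmE Hijk n (d - n).
    have nd : (n <= d)%N by have := ltn_ord n; rewrite ltnS.
    by rewrite (natrB _ nd) expr1n mulr1 mulrA -mulrBl -mulrBl.
  by rewrite s1 s2 mulr0 subrr.
Qed.

Lemma dehom_edge_poly : dehom F i k = map_poly tofrac p.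
Proof.
have := Hijk; rewrite /= !inE !negb_or andbT -andbA => /and3P[ij ik jk].
rewrite /dehom (mmap_edge Hijk HF) ?eqxx // (eq_sym j) (negbTE ij) (negbTE jk).
rewrite (eq_sym k) (negbTE ik) /edge_poly poly_def rmorph_sum.
apply: eq_bigr => n _ /=.
by rewrite expr1n mulr1 map_polyZ map_polyXn mul_polyC.
Qed.

(** A vanishing resultant yields a nonconstant gcd of the polynomial and its derivative, whose root
    in the algebraically closed [L] would be a double root. *)
Lemma resultant_dehom_neq0 : resultant (dehom F i k) (dehom F i k)^`() != 0.
Proof.
rewrite dehom_edge_poly resultant_eq0; apply/negP.
set q := map_poly _ _ => sg.
have : (size (map_poly iota (gcdp q q^`()))%R != 1)%N.
  by rewrite size_map_poly neq_ltn sg orbT.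
case/closed_rootP => a; rewrite gcdp_map root_gcd -deriv_map -map_poly_comp.
by case/andP; apply: edge_poly_no_double_root.
Qed.

(** In [Delta_star] the factor F_{d e_j} cancels the leading coefficient dividing in [disc]; what is
    left is F_{d e_k} times the resultant, up to the sign of the discriminant. *)
Lemma det_edge_sylvester :
  tofrac (\det (euler_sylvester d p)) =
    (-1) ^+ odd (d * d.-1)./2 * Delta_star F d i j k.
Proof.
have szK : size (map_poly tofrac p) = d.+1.
  by rewrite size_map_inj_poly ?size_edge_poly ?rmorph0 //; apply: tofrac_inj.
have -> : tofrac (\det (euler_sylvester d p)) =
          \det (euler_sylvester d (map_poly tofrac p)).
  by rewrite -det_map_mx map_euler_sylvester.
rewrite det_euler_sylvester // ?deriv_map; last first.
  by rewrite size_map_inj_poly ?size_deriv_edge_poly ?rmorph0 //; apply: tofrac_inj.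
rewrite /Delta_star /disc dehom_edge_poly szK /= signr_odd.
rewrite lead_coefE szK /= !coef_map /= !coef_edge_poly // subn0 subnn.
rewrite /edge_mnm !mulm0n addm0 add0m deriv_map.
have top : tofrac F@_(U_(j) *+ d)%MM != 0.
  by have := edge_poly_top_neq0; rewrite coef_edge_poly // subnn /edge_mnm mulm0n addm0 tofrac_eq0.
have aux (K : fieldType) (s c r t : K) :
    s * s = 1 -> t != 0 -> c * r = s * (t * c * (s * r / t)).
  by move=> ss t0; transitivity (s * s * (c * r)); [rewrite ss mul1r | field].
by apply: aux => //; rewrite -expr2 sqrr_sign.
Qed.

Lemma Delta_star_neq0 : Delta_star F d i j k != 0.
Proof.
have top := edge_poly_top_neq0; have bot := edge_poly_bot_neq0.
move: top bot; rewrite !coef_edge_poly // subnn subn0 /edge_mnm !mulm0n addm0 add0m.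
move=> top bot; rewrite /Delta_star /disc !mulf_neq0 ?tofrac_eq0 ?signr_eq0 //.
  exact: resultant_dehom_neq0.
rewrite invr_eq0 dehom_edge_poly lead_coef_eq0 map_poly_eq0_id0 ?tofrac_eq0.
  by rewrite -size_poly_eq0 size_edge_poly.
by rewrite lead_coef_eq0 -size_poly_eq0 size_edge_poly.
Qed.

End Discriminant.

(** * Extending the coefficients of an element of E across the new face *)

Lemma sum_coefMXn (R : nzRingType) (q : {poly R}) (s e M : nat) (N : nat -> R) :
  (size q <= e)%N -> (s + e <= M)%N ->
  \sum_(c < M) (q * 'X^s)`_c * N c = \sum_(n < e) q`_n * N (s + n)%N.
Proof.
move=> sq sM; rewrite -(big_mkord predT (fun c => (q * 'X^s)`_c * N c)).
rewrite (big_cat_nat (n := s)) //=; last by lia.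
rewrite big_nat_cond big1 ?add0r => [|c /andP[/andP[_ cs] _]]; last first.
  by rewrite coefMXn cs mul0r.
rewrite (big_cat_nat (n := s + e)) //=; last by lia.
rewrite [X in _ + X]big_nat_cond [X in _ + X]big1 ?addr0 => [|c]; last first.
  move=> /andP[/andP[ce _] _]; rewrite coefMXn ltnNge (leq_trans (leq_addr e s) ce) /=.
  by rewrite nth_default ?mul0r // (leq_trans sq) //; lia.
rewrite -{1}[s]add0n big_addn addKn big_mkord; apply: eq_bigr => n _.
by rewrite coefMXn addnC ltnNge leq_addr /= addKn.
Qed.

Lemma zvecD u w : zvec (u + w) = zvec u + zvec w.
Proof. by apply/rowP => h; rewrite !mxE mnmDE PoszD. Qed.

Lemma zvecU h : zvec U_(h) = e3 h.
Proof. by apply/rowP => h'; rewrite !mxE mnm1E eqxx [h == _]eq_sym; case: eqP. Qed.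

Lemma zvec_inj : injective zvec.
Proof. by move=> u w /rowP uw; apply/mnmP => h; have := uw h; rewrite !mxE => -[]. Qed.

(** The exponent s with s_i = 0 to which row [r] of the system belongs. Each s occurs at the two
    rows s_j and s_j + d, since two equations are kept at s. *)
Definition face_mnm (j k : 'I_3) (d r : nat) : 'X_{1..3} :=
  let s := if (r < d)%N then r else (r - d)%N in edge_mnm j k s (d.-1 - s).

Lemma mdeg_face_mnm (i j k : 'I_3) (d r : nat) :
  uniq [:: i; j; k] -> (r < 2 * d)%N -> mdeg (face_mnm j k d r) = d.-1.
Proof. by move=> Hijk rd; rewrite /face_mnm (mdeg_edge Hijk); case: ifP; lia. Qed.

Section Extension.
Variables (i j k : 'I_3).
Hypothesis Hijk : uniq [:: i; j; k].
Variables (K : comNzRingType) (d m : nat) (v : 'rV[int]_3).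
Hypothesis d_gt0 : (0 < d)%N.
Variables (a : 'X_{1..3} -> K) (p : {poly K}).
Hypothesis sp : (size p <= d.+1)%N.
Hypothesis pE : forall n, (n <= d)%N -> p`_n = a (edge_mnm j k n (d - n)).
Let l := (2 * d - 2)%N.
Let v' : 'rV[int]_3 := v + e3 i.

Definition espace_eq (w : 'rV[int]_3) (g : 'rV[int]_3 -> K)
    (s : 'X_{1..3}) (h : 'I_3) : Prop :=
  (w 0 h - (s h)%:Z)%:~R * (\sum_(t <- Dexp d) a t * g (w - zvec s - zvec t)) =
  (m + 1)%:R * (\sum_(t <- Dexp d) (t h)%:R * a t * g (w - zvec s - zvec t)).

(* The equation with index [h = i] at [s = face_mnm j k d r] ([r < d]), and the
   combination of those with indices [i] and [j] that remains after division
   by [m + 1] ([d <= r]). *)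
Definition rhs_coef (r : nat) (t : 'X_{1..3}) : K :=
  if (r < d)%N then (m%:R + 1) * (t i)%:R - ((v 0 i)%:~R + 1)
  else ((v 0 j)%:~R - (r - d)%:R) * (t i)%:R - ((v 0 i)%:~R + 1) * (t j)%:R.

(** Only old coefficients enter: for t_i <> 0 the point v' - s - t is v - (s + t - e_i), and s + t -
    e_i has degree 2d - 2 = [l]. *)
Definition extension_rhs (g : 'rV[int]_3 -> K) (r : nat) : K :=
  \sum_(t <- Dexp d | t i != 0%N)
    a t * rhs_coef r t * g (v' - zvec (face_mnm j k d r) - zvec t).

(** Multiplication by X^s moves the coefficient of index t_j to s + t_j, and passing from p to X p'
    weights it by t_j. *)
Lemma euler_sylvester_row (N : nat -> K) (r : 'I_(2 * d)) :
  \sum_c euler_sylvester d p r c * N c =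
  \sum_(t <- Dexp d | t i == 0%N)
     (if (r < d)%N then 1 else (t j)%:R) * a t * N (face_mnm j k d r j + t j)%N.
Proof.
rewrite (sum_Dexp_edge Hijk) /face_mnm.
under eq_bigr do rewrite mxE.
case: ifP => rd.
  rewrite (@sum_coefMXn _ p r d.+1) ?sp //; last by lia.
  apply: eq_bigr => n _; rewrite pE -1?ltnS // mul1r.
  have [_ -> _] := edge_mnmE Hijk n (d - n).
  by have [_ -> _] := edge_mnmE Hijk r (d.-1 - r).
rewrite (@sum_coefMXn _ ('X * p^`()) (r - d) d.+1); first last.
- by have := ltn_ord r; lia.
- have [->|p'0] := eqVneq p^`() 0; first by rewrite mulr0 size_poly0.
  rewrite -commr_polyX size_mulX // ltnS -ltnS.
  by apply: leq_trans (lt_size_deriv _) sp; apply: contraNneq p'0 => ->; rewrite derivC.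
apply: eq_bigr => n _; have [_ -> _] := edge_mnmE Hijk n (d - n).
have [_ -> _] := edge_mnmE Hijk (r - d) (d.-1 - (r - d)); congr (_ * _).
rewrite coefXM; case: n => -[|n] nd /=; first by rewrite mul0r.
by rewrite coef_deriv pE // mulr_natl.
Qed.

Variables (g g' : 'rV[int]_3 -> K) (theta : K).
Hypothesis vdeg : zdeg v = (d * m + l)%:Z.
Hypothesis g'_old : forall u, mdeg u = l ->
  g' (v - zvec u) = ((v 0 i)%:~R + 1) * theta * g (v - zvec u).
Hypothesis g'_new : forall r : 'I_(2 * d),
  \sum_c euler_sylvester d p r c * g' (v' - zvec (edge_mnm j k c (2 * d - 1 - c))) =
  theta * extension_rhs g r.
Hypothesis gE : forall s h, mdeg s = (l - d)%N -> espace_eq v g s h.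

Lemma v'_sub (u : 'X_{1..3}) : v' - zvec (u + U_(i)) = v - zvec u.
Proof. by rewrite zvecD zvecU /v' opprD addrACA subrr addr0. Qed.

(** With s = s' + e_i only old coefficients occur, v'_h - s_h = v_h - s'_h, and the equation is (v_i
    + 1) theta times the one for [g] at s'. *)
Lemma extension_espace_inner (s : 'X_{1..3}) (h : 'I_3) :
  s i != 0%N -> mdeg s = (l + 1 - d)%N -> espace_eq v' g' s h.
Proof.
move=> si ds.
have [s' sE] : exists s', s = (s' + U_(i))%MM.
  by exists (s - U_(i))%MM; rewrite submK // lep1mP.
have ds' : mdeg s' = (l - d)%N by move: ds; rewrite sE mdegD mdeg1; lia.
have d2 : (d <= l)%N by move: ds; rewrite sE mdegD mdeg1 /l; lia.
have tE t : t \in Dexp d -> g' (v' - zvec s - zvec t) =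
    ((v 0 i)%:~R + 1) * theta * g (v - zvec s' - zvec t).
  rewrite mem_Dexp => /eqP dt; rewrite sE v'_sub -[v - _ - _]addrA -opprD -zvecD.
  by apply: g'_old; rewrite mdegD ds' dt; lia.
rewrite /espace_eq.
have -> : v' 0 h - (s h)%:Z = v 0 h - (s' h)%:Z.
  by rewrite sE /v' !mxE mnmDE mnm1E eqxx [h == i]eq_sym; case: eqP => _ /=; lia.
set c := ((v 0 i)%:~R + 1) * theta in tE.
transitivity (c * ((v 0 h - (s' h)%:Z)%:~R *
    (\sum_(t <- Dexp d) a t * g (v - zvec s' - zvec t)))).
  rewrite [RHS]mulrCA [c * _]mulr_sumr; congr (_ * _); apply: eq_big_seq => t td.
  by rewrite tE // mulrCA.
rewrite (gE h ds') [LHS]mulrCA [c * _]mulr_sumr; congr (_ * _); apply: eq_big_seq => t td.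
by rewrite tE // mulrCA.
Qed.

(** Each sum over t splits into the terms with t_i = 0, which are new and governed by [g'_new], and
    those with t_i <> 0, which are old and given by [g'_old]. *)
Lemma extension_espace_face (s : 'X_{1..3}) (h : 'I_3) :
  s i = 0%N -> mdeg s = (l + 1 - d)%N -> espace_eq v' g' s h.
Proof.
move=> si ds.
have ds1 : mdeg s = d.-1 by rewrite ds /l; lia.
have sjk : (s j + s k = d.-1)%N by rewrite -ds1 (mdeg3 Hijk) si.
have sE : s = edge_mnm j k (s j) (d.-1 - s j).
  have [ei ej ek] := edge_mnmE Hijk (s j) (d.-1 - s j).
  by apply: (mnm3P Hijk); rewrite ?ei ?ej ?ek //; lia.
(* [c] and [b] are the factors v'_i - s_i and v'_j - s_j of the equations h = i and h = j. [T] gives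
   the terms for [g'], and [X] sums the old terms before scaling. *)
pose c : K := (v 0 i)%:~R + 1; pose b : K := (v 0 j)%:~R - (s j)%:R.
pose T (t : 'X_{1..3}) := a t * g' (v' - zvec s - zvec t).
pose X (f : 'X_{1..3} -> K) := \sum_(t <- Dexp d | t i != 0%N) f t * (a t * g (v' - zvec s - zvec t)).
have inner f : \sum_(t <- Dexp d | t i != 0%N) f t * T t = c * theta * X f.
  rewrite /X mulr_sumr big_seq_cond [RHS]big_seq_cond.
  apply: eq_bigr => t /andP[td ti].
  have [t' tE] : exists t', t = (t' + U_(i))%MM.
    by exists (t - U_(i))%MM; rewrite submK // lep1mP.
  have st : v' - zvec s - zvec t = v - zvec (s + t').
    by rewrite -v'_sub -addmA -tE [in RHS]zvecD opprD addrA.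
  rewrite /T st g'_old ?/c; first by ring.
  by move: td; rewrite mem_Dexp tE !mdegD mdeg1 ds1 /l; lia.
have face (t : 'X_{1..3}) : t \in Dexp d -> t i = 0%N ->
    v' - zvec s - zvec t =
    v' - zvec (edge_mnm j k (s j + t j) (2 * d - 1 - (s j + t j))).
  rewrite mem_Dexp (mdeg3 Hijk) => /eqP dt ti; rewrite -addrA -opprD -zvecD.
  congr (_ - zvec _).
  have [ei ej ek] := edge_mnmE Hijk (s j + t j) (2 * d - 1 - (s j + t j)).
  by apply: (mnm3P Hijk); rewrite ?ei ?ej ?ek mnmDE //; lia.
have outer r (rd : (r < 2 * d)%N) : face_mnm j k d r = s ->
    \sum_(t <- Dexp d | t i == 0%N) (if (r < d)%N then 1 else (t j)%:R) * T t =
    theta * X (rhs_coef r).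
  move=> rs; transitivity (theta * extension_rhs g r); last first.
    rewrite /extension_rhs /X rs; congr (_ * _); apply: eq_bigr => t _.
    by rewrite mulrA [a t * _]mulrC.
  rewrite -(g'_new (Ordinal rd)).
  rewrite (euler_sylvester_row
    (fun c => g' (v' - zvec (edge_mnm j k c (2 * d - 1 - c))))) /= rs.
  rewrite big_seq_cond [RHS]big_seq_cond; apply: eq_bigr => t /andP[td /eqP ti].
  by rewrite /T (face t td ti) mulrA.
have XD (f1 f2 : 'X_{1..3} -> K) y1 y2 :
    X (fun t => y1 * f1 t - y2 * f2 t) = y1 * X f1 - y2 * X f2.
  rewrite /X !mulr_sumr -sumrB; apply: eq_bigr => t _; ring.
have eqX f1 f2 : f1 =1 f2 -> X f1 = X f2.
  by move=> f12; apply: eq_bigr => t _; rewrite f12.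
(* Row s_j of the system gives the new terms with weight 1, row s_j + d those with weight t_j. *)
have out1 : \sum_(t <- Dexp d | t i == 0%N) T t =
    theta * ((m%:R + 1) * X (fun t : 'X_{1..3} => (t i)%:R) - c * X (fun=> 1)).
  have := @outer (s j) ltac:(lia); rewrite /face_mnm (_ : (s j < d)%N) -?sE; last by lia.
  under eq_bigr do rewrite mul1r.
  move=> ->//; rewrite -XD; congr (_ * _); apply: eqX => t.
  by rewrite /rhs_coef (_ : (s j < d)%N) ?mulr1 //; lia.
have out2 : \sum_(t <- Dexp d | t i == 0%N) (t j)%:R * T t =
    theta * (b * X (fun t : 'X_{1..3} => (t i)%:R) - c * X (fun t : 'X_{1..3} => (t j)%:R)).
  have := @outer (s j + d)%N ltac:(lia).
  rewrite /face_mnm ltnNge leq_addl /= addnK -sE.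
  move=> ->//; rewrite -XD; congr (_ * _); apply: eqX => t.
  by rewrite /rhs_coef ltnNge leq_addl /= addnK.
(* Adding the old terms cancels the subtracted multiples of [c]. The sums with weights 1, t_i and
   t_j become theta (m + 1), theta c and theta b times the single sum X(t_i), which gives the
   equations h = i and h = j. *)
pose M (f : 'X_{1..3} -> K) := \sum_(t <- Dexp d) f t * T t.
have M1 : M (fun=> 1) = theta * ((m%:R + 1) * X (fun t : 'X_{1..3} => (t i)%:R)).
  rewrite /M (bigID (fun t : 'X_{1..3} => t i == 0%N)) /= inner.
  under eq_bigr do rewrite mul1r.
  by rewrite out1; ring.
have Mi : M (fun t : 'X_{1..3} => (t i)%:R) = c * theta * X (fun t : 'X_{1..3} => (t i)%:R).
  rewrite /M (bigID (fun t : 'X_{1..3} => t i == 0%N)) /= inner.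
  by rewrite big1 ?add0r // => t /eqP ->; rewrite mul0r.
have Mj : M (fun t : 'X_{1..3} => (t j)%:R) = theta * (b * X (fun t : 'X_{1..3} => (t i)%:R)).
  rewrite /M (bigID (fun t : 'X_{1..3} => t i == 0%N)) /= inner out2; ring.
(* The equation h = k follows by summation, from t_i + t_j + t_k = d on one side and deg v' - deg s
   = d (m + 1) on the other. *)
have Mk : M (fun t : 'X_{1..3} => (t k)%:R) =
    d%:R * M (fun=> 1) - M (fun t : 'X_{1..3} => (t i)%:R) - M (fun t : 'X_{1..3} => (t j)%:R).
  rewrite /M mulr_sumr -!sumrB; apply: eq_big_seq => t; rewrite mem_Dexp => /eqP <-.
  by rewrite (mdeg3 Hijk) !natrD; ring.
suff: (v' 0 h - (s h)%:Z)%:~R * M (fun=> 1) = (m + 1)%:R * M (fun t : 'X_{1..3} => (t h)%:R).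
  rewrite /espace_eq /M; under eq_bigr do rewrite mul1r.
  by move=> ->; congr (_ * _); apply: eq_bigr => t _; rewrite mulrA.
have v'i : (v' 0 i - (s i)%:Z)%:~R = c.
  by rewrite si subr0 /v' !mxE !eqxx rmorphD.
have := Hijk; rewrite /= !inE !negb_or andbT -andbA => /and3P[ij ik jk].
have v'j : (v' 0 j - (s j)%:Z)%:~R = b.
  by rewrite /v' !mxE eqxx eq_sym (negbTE ij) /= addr0 rmorphB.
have v'k : (v' 0 k - (s k)%:Z)%:~R = d%:R * (m + 1)%:R - c - b.
  have -> : v' 0 k - (s k)%:Z = d%:Z * (m + 1)%:Z - (v 0 i + 1) - (v 0 j - (s j)%:Z).
    rewrite /v' !mxE eqxx eq_sym (negbTE ik) /= addr0.
    by move: vdeg; rewrite /zdeg (big_ord3_uniq Hijk) /= /l; nia.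
  by rewrite !(rmorphB, rmorphD, rmorphM).
elim/(ord3_cases Hijk): h.
- by rewrite v'i M1 Mi natrD; ring.
- by rewrite v'j M1 Mj natrD; ring.
- by rewrite v'k Mk M1 Mi Mj natrD; ring.
Qed.

Lemma extension_espace (s : 'X_{1..3}) (h : 'I_3) : mdeg s = (l + 1 - d)%N -> espace_eq v' g' s h.
Proof.
by have [] := eqVneq (s i) 0%N;
  [apply: extension_espace_face | apply: extension_espace_inner].
Qed.

End Extension.

(** * The matrix entries as polynomials of degree at most 1 in v and m *)

Lemma msize_sum_le (R : nzRingType) (n e : nat) (I : Type) (s : seq I) (P : pred I)
    (f : I -> {mpoly R[n]}) :
  (forall x, P x -> (msize (f x) <= e)%N) -> (msize (\sum_(x <- s | P x) f x) <= e)%N.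
Proof.
move=> hf; elim/big_rec: _ => [|x p Px hp]; first by rewrite mmeasure0.
by apply: leq_trans (mmeasureD_le _ _ _) _; rewrite geq_max hf.
Qed.

Section Entries.
Variables (i j k : 'I_3) (R : idomainType) (d : nat) (F : {mpoly R[3]}).
Hypothesis Hijk : uniq [:: i; j; k].
Hypothesis d_gt0 : (0 < d)%N.
Let l := (2 * d - 2)%N.
Local Notation S := (euler_sylvester d (edge_poly j k d F)).
Local Notation Xv h := ('X_(lift ord_max h) : {mpoly R[4]}).
Local Notation Xm := ('X_ord_max : {mpoly R[4]}).

Definition rhs_coef_poly (r : nat) (t : 'X_{1..3}) : {mpoly R[4]} :=
  if (r < d)%N then (t i)%:R *: (Xm + 1%:MP) - (Xv i + 1%:MP)
  else (t i)%:R *: (Xv j - (r - d)%:R%:MP) - (t j)%:R *: (Xv i + 1%:MP).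

(** The coefficient of g at v - w in the right-hand side of row [r]: the term t contributes exactly
    when s + t = w + e_i. *)
Definition rhs_poly (r : nat) (w : 'X_{1..3}) : {mpoly R[4]} :=
  \sum_(t <- Dexp d | (t i != 0%N) && (face_mnm j k d r + t == w + U_(i))%MM)
     F@_t *: rhs_coef_poly r t.

(** If u_i <> 0, the row belongs to an old monomial, which is scaled by (v_i + 1) det S. Otherwise
    it belongs to the new unknown of index u_j, given by row u_j of adj(S) times the right-hand
    side; the sum over [c] only turns u_j into an ordinal. *)
Definition extension_entry (u w : 'X_{1..3}) : {mpoly R[4]} :=
  if u i != 0%N then
    if u == (w + U_(i))%MM then \det S *: (Xv i + 1%:MP) else 0
  else \sum_(r < 2 * d) \sum_(c < 2 * d | c == u j :> nat)
         (\adj S) c r *: rhs_poly r w.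

(** [msize] is the degree plus one. The determinant and adjugate of S are constants from [R], so
    only the affine factors in v and m count. *)
Lemma msize_extension_entry u w : (msize (extension_entry u w) <= 2)%N.
Proof.
have aD (p q : {mpoly R[4]}) : (msize p <= 2)%N -> (msize q <= 2)%N -> (msize (p + q) <= 2)%N.
  by move=> hp hq; apply: leq_trans (mmeasureD_le _ _ _) _; rewrite geq_max hp.
have aN (p : {mpoly R[4]}) : (msize p <= 2)%N -> (msize (- p) <= 2)%N.
  by rewrite mmeasureN.
have aZ c (p : {mpoly R[4]}) : (msize p <= 2)%N -> (msize (c *: p) <= 2)%N.
  by apply: leq_trans (msizeZ_le _ _).
have aC c : (msize (c%:MP : {mpoly R[4]}) <= 2)%N.
  by apply: leq_trans (leq_ltn_trans (leq_b1 (c != 0)) _); rewrite ?mmeasureC.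
have aX (h : 'I_4) : (msize ('X_h : {mpoly R[4]}) <= 2)%N by rewrite msizeX mdeg1.
rewrite /extension_entry; case: ifP => _.
  by case: ifP => _; [apply/aZ/aD | rewrite mmeasure0].
apply: msize_sum_le => r _; apply: msize_sum_le => c _; apply/aZ.
apply: msize_sum_le => t _; apply/aZ.
by rewrite /rhs_coef_poly; case: ifP => _; do ?[apply/aD|apply/aN|apply/aZ].
Qed.

Variables (K : comNzRingType) (f : {rmorphism R -> K}) (m : nat) (v : 'rV[int]_3).
Local Notation ev q := (f (meval (vmpt R v m) q)).

Lemma eval_sum (I : Type) (s : seq I) (P : pred I) (q : I -> {mpoly R[4]}) :
  ev (\sum_(x <- s | P x) q x) = \sum_(x <- s | P x) ev (q x).
Proof. by rewrite (rmorph_sum (meval (vmpt R v m))) rmorph_sum. Qed.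

Lemma eval_Xv h : ev (Xv h) = (v 0 h)%:~R.
Proof. by rewrite mevalXU /vmpt liftK rmorph_int. Qed.

Lemma eval_Xm : ev Xm = m%:R.
Proof. by rewrite mevalXU /vmpt unlift_none rmorph_nat. Qed.

Lemma eval_rhs_coef r t : ev (rhs_coef_poly r t) = rhs_coef i j K d m v r t.
Proof.
rewrite /rhs_coef_poly /rhs_coef; case: ifP => _;
  rewrite !(mevalB, mevalZ, mevalD, mevalC) !(rmorphB, rmorphM, rmorphD) /=;
  rewrite !(eval_Xv, eval_Xm) !(rmorph_nat, rmorph1); ring.
Qed.

Variable g : 'rV[int]_3 -> K.
Local Notation val u w := (ev (extension_entry u w)).

Lemma eval_entry_old u : mdeg u = l ->
  \sum_(w <- Dexp l) val (u + U_(i))%MM w * g (v - zvec w) =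
  ((v 0 i)%:~R + 1) * f (\det S) * g (v - zvec u).
Proof.
move=> du; rewrite (bigD1_seq u) ?uniq_Dexp ?mem_Dexp ?du //=.
rewrite big1 ?addr0 => [|w wu]; rewrite /extension_entry mnmDE mnm1E eqxx addn1 /=.
  rewrite eqxx mevalZ mevalD mevalC rmorphM rmorphD eval_Xv rmorph1.
  by rewrite [f _ * _]mulrC.
by rewrite eqm_add2r eq_sym (negbTE wu) meval0 rmorph0 mul0r.
Qed.

Lemma eval_rhs r : (r < 2 * d)%N ->
  \sum_(w <- Dexp l) ev (rhs_poly r w) * g (v - zvec w) =
  extension_rhs i j k d m v (fun t => f F@_t) g r.
Proof.
move=> rd; rewrite /extension_rhs /rhs_poly.
pose T (t : 'X_{1..3}) (w : 'X_{1..3}) := f F@_t * rhs_coef i j K d m v r t * g (v - zvec w).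
transitivity (\sum_(w <- Dexp l) \sum_(t <- Dexp d | t i != 0%N)
    if (face_mnm j k d r + t == w + U_(i))%MM then T t w else 0).
  apply: eq_bigr => w _; rewrite big_mkcondr /= eval_sum mulr_suml.
  apply: eq_bigr => t _; case: ifP => _; last by rewrite meval0 rmorph0 mul0r.
  by rewrite mevalZ rmorphM eval_rhs_coef.
rewrite exchange_big /= big_seq_cond [RHS]big_seq_cond; apply: eq_bigr => t.
rewrite mem_Dexp => /andP[/eqP dt ti].
(* As t_i <> 0, exactly one w receives the term of t. *)
have [w wE] : exists w, (face_mnm j k d r + t = w + U_(i))%MM.
  by exists (face_mnm j k d r + t - U_(i))%MM; rewrite submK // lep1mP mnmDE addn_eq0 negb_and ti orbT.
have dw : mdeg w = l.
  have := congr1 (@mdeg 3) wE; rewrite mdegD (mdeg_face_mnm Hijk) // dt mdegD mdeg1 /l; lia.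
rewrite (bigD1_seq w) ?uniq_Dexp ?mem_Dexp ?dw //= wE eqxx big1 ?addr0 => [|x xw].
  congr (_ * g _); rewrite -[RHS]addrA -opprD -zvecD wE zvecD zvecU.
  by rewrite opprD addrACA subrr addr0.
by rewrite eqm_add2r eq_sym (negbTE xw).
Qed.

(** The new coefficients are adj(S) times the right-hand side, and S adj(S) is the scalar matrix det
    S. *)
Lemma eval_entry_new (r : 'I_(2 * d)) :
  \sum_c euler_sylvester d (map_poly f (edge_poly j k d F)) r c *
    (\sum_(w <- Dexp l) val (edge_mnm j k c (2 * d - 1 - c)) w * g (v - zvec w)) =
  f (\det S) * extension_rhs i j k d m v (fun t => f F@_t) g r.
Proof.
pose B := \col_(r < 2 * d) extension_rhs i j k d m v (fun t => f F@_t) g r.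
have entryE (c : 'I_(2 * d)) :
    \sum_(w <- Dexp l) val (edge_mnm j k c (2 * d - 1 - c)) w * g (v - zvec w) =
    (map_mx f (\adj S) *m B) c 0.
  rewrite mxE; under [RHS]eq_bigr do rewrite !mxE -eval_rhs // mulr_sumr.
  rewrite [RHS]exchange_big; apply: eq_bigr => w _.
  have [ei ej _] := edge_mnmE Hijk c (2 * d - 1 - c).
  rewrite /extension_entry ei ej /= eval_sum mulr_suml.
  apply: eq_bigr => q _; rewrite (big_pred1 c) //.
  by rewrite mevalZ rmorphM mulrA mxE.
rewrite -map_euler_sylvester; under eq_bigr do rewrite entryE.
have -> : \sum_c map_mx f S r c * (map_mx f (\adj S) *m B) c 0 =
          (map_mx f S *m (map_mx f (\adj S) *m B)) r 0 by rewrite [RHS]mxE.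
by rewrite mulmxA -map_mxM mul_mx_adj map_scalar_mx mul_scalar_mx !mxE.
Qed.

End Entries.

(** * Linear maps between spaces of Laurent polynomials given by matrices *)

Section LaurentMap.
Variable K : fieldType.

Lemma laurentP (G H : laurent K) : lcoef G =1 lcoef H -> G = H.
Proof. exact: (monalg.malgP G H).1. Qed.

Lemma lcoefD (G H : laurent K) z : lcoef (G + H) z = lcoef G z + lcoef H z.
Proof. exact: monalg.mcoeffD. Qed.

Lemma lcoefZ c (G : laurent K) z : lcoef (c *: G) z = c * lcoef G z.
Proof. exact: monalg.mcoeffZ. Qed.

Lemma lcoef_lmon (x z : 'rV[int]_3) : lcoef (lmon K x) z = (x == z)%:R.
Proof. by rewrite /lcoef /lmon monalg.mcoeffU. Qed.

Lemma lcoef_sum (I : Type) (s : seq I) (c : I -> K) (x : I -> 'rV[int]_3) z :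
  lcoef (\sum_(q <- s) c q *: lmon K (x q)) z = \sum_(q <- s) c q * (x q == z)%:R.
Proof.
rewrite (big_morph (fun G : laurent K => lcoef G z)
  (fun G H => lcoefD G H z) (monalg.mcoeff0 z)).
by apply: eq_bigr => q _; rewrite lcoefZ lcoef_lmon.
Qed.

Lemma lcoef_restrict (s : seq 'rV[int]_3) (G : laurent K) z :
  uniq s -> lcoef (restrict s G) z = if z \in s then lcoef G z else 0.
Proof.
move=> us; rewrite /restrict (lcoef_sum s (lcoef G) id).
case: ifP => zs; last first.
  by rewrite big_seq big1 // => x xs; case: eqP => [xz|_]; last exact: mulr0; rewrite -xz xs in zs.
rewrite (bigD1_seq z) //= eqxx mulr1 big1 ?addr0 // => x /negbTE ->.
by rewrite mulr0.
Qed.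

Lemma mem_Dpts v l u : (v - zvec u \in Dpts v l) = (mdeg u == l).
Proof.
apply/mapP/eqP => [[w]|du]; last by exists u; rewrite // mem_Dexp du.
by rewrite mem_Dexp => /eqP dw /addrI/oppr_inj/zvec_inj ->.
Qed.

Lemma uniq_Dpts v l : uniq (Dpts v l).
Proof. by rewrite map_inj_uniq ?uniq_Dexp // => u w /addrI/oppr_inj/zvec_inj. Qed.

Lemma linear_map_on (s s' : seq 'rV[int]_3) (f : laurent K -> laurent K) :
  (forall c G H, f (c *: G + H) = c *: f G + f H) ->
  (forall G, f G \is a supported K s') ->
  exists phi : {linear laurent_on K s -> laurent_on K s'},
    forall G, lval (phi G) = f (lval G).
Proof.
move=> f_lin f_sup.
pose g (G : laurent_on K s) : laurent_on K s' := LaurentOn (f_sup (lval G)).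
have g_lin : linear g by move=> c G H; apply: val_inj; apply: f_lin.
pose gL := GRing.isLinear.Build K (laurent_on K s) (laurent_on K s') _ g g_lin.
pose phi : {linear laurent_on K s -> laurent_on K s'} := HB.pack g gL.
by exists phi.
Qed.

Lemma matrix_linear_map (v v' : 'rV[int]_3) (l l' : nat)
    (a : 'X_{1..3} -> 'X_{1..3} -> K) :
  exists phi : {linear Dspace K v l -> Dspace K v' l'},
    forall G u, mdeg u = l' ->
      lcoef (lval (phi G)) (v' - zvec u) =
      \sum_(w <- Dexp l) a u w * lcoef (lval G) (v - zvec w).
Proof.
have [b bE] : exists b : laurent K -> 'X_{1..3} -> K,
    forall G u, b G u = \sum_(w <- Dexp l) a u w * lcoef G (v - zvec w).
  by eexists.
have [f fE] : exists f : laurent K -> laurent K,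
    forall G, f G = \sum_(u <- Dexp l') b G u *: lmon K (v' - zvec u).
  by eexists.
have lcoef_f G z :
    lcoef (f G) z = \sum_(u <- Dexp l') b G u * (v' - zvec u == z)%:R.
  by rewrite fE (lcoef_sum _ (b G) (fun u => v' - zvec u)).
have f_lin c G H : f (c *: G + H) = c *: f G + f H.
  apply: laurentP => z; rewrite lcoefD lcoefZ !lcoef_f mulr_sumr -big_split.
  apply: eq_bigr => u _; rewrite [RHS]/= mulrA -mulrDl; congr (_ * _).
  rewrite !bE mulr_sumr -big_split; apply: eq_bigr => w _ /=.
  by rewrite lcoefD lcoefZ mulrDr !mulrA [c * _]mulrC.
have f_sup G : f G \is a supported K (Dpts v' l').
  rewrite fE big_seq; apply: rpred_sum => u; rewrite mem_Dexp => du.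
  by apply/rpredZ/lmon_supported; rewrite mem_Dpts.
have [phi phiE] := linear_map_on (Dpts v l) f_lin f_sup.
exists phi => G u du; rewrite phiE lcoef_f -bE.
rewrite (bigD1_seq u) ?uniq_Dexp ?mem_Dexp ?du //= eqxx mulr1 big1 ?addr0 // => w wu.
case: eqP => [/addrI/oppr_inj/zvec_inj wE|_]; last exact: mulr0.
by rewrite wE eqxx in wu.
Qed.

End LaurentMap.

(** * Assembly of phi from the extension matrix *)

Theorem lemma4p4 (R : idomainType) (HR : Z_or_Fp R)
    (L : closedFieldType) (iota : {rmorphism {fraction R} -> L})
    (HL : forall z : L, algebraicOver iota z)
    (d : nat) (Hd : (2 <= d)%N)
    (F : {mpoly R[3]}) (HFd : F \is d.-homog) (HFn : nondegenerate_form iota F)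
    (i j k : 'I_3) (Hijk : uniq [:: i; j; k]) :
  let l := (2 * d - 2)%N in
  exists (sgn : bool)
         (A : 'M[{mpoly R[4]}]_('C(2 * d + 1, 2), 'C(2 * d, 2))),
    let theta := (-1) ^+ sgn * Delta_star F d i j k in
    (forall r c, (msize (A r c) <= 2)%N) /\
    forall m : nat, (0 < m)%N -> (d * (m + 1))%:R != 0 :> R ->
      theta != 0 /\
      forall v : 'rV[int]_3, zdeg v = (d * m + l)%:Z ->
      exists phi : {linear Dspace {fraction R} v l ->
                           Dspace {fraction R} (v + e3 i) (l + 1)},
        [/\ forall G, lval (Pmap i (phi G)) =
                        ((v 0 i + 1)%:~R * theta) *: lval G,
            (v 0 i + 1)%:~R != 0 :> R ->
              forall G, in_Espace F d m G -> in_Espace F d m (phi G)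
          & represents phi
              (map_mx (meval (vmpt R v m)) A)].
Proof.
move=> l; have d_gt0 : (0 < d)%N by apply: leq_trans Hd.
(* The matrix is chosen before m. If d = 0 in [R], then d (m + 1) = 0 for every m, and any matrix
   will do. *)
have [d0|dR] := eqVneq (d%:R : R) 0.
  exists false, 0; split=> [r c|m _]; first by rewrite mxE mmeasure0.
  by rewrite natrM d0 mul0r eqxx.
(* This sign is that of the discriminant and makes theta equal to det S. *)
exists (odd (d * d.-1)./2), (\matrix_(r, c) extension_entry i j k d F
  (nth 0%MM (Dexp (l + 1)) r) (nth 0%MM (Dexp l) c)).
move=> theta.
have thetaE : theta = FracField.tofrac (\det (euler_sylvester d (edge_poly j k d F))).
  by rewrite (det_edge_sylvester d_gt0 dR HFd HFn Hijk).
split=> [r c|m _ _]; first by rewrite mxE msize_extension_entry.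
split; first by rewrite mulf_neq0 ?signr_eq0 // (Delta_star_neq0 d_gt0 dR HFd HFn Hijk).
move=> v vdeg.
pose a u w := FracField.tofrac (meval (vmpt R v m) (extension_entry i j k d F u w)).
have [phi phiE] := matrix_linear_map v (v + e3 i) l (l + 1) a.
have old G u : mdeg u = l -> lcoef (lval (phi G)) (v - zvec u) =
    ((v 0 i)%:~R + 1) * theta * lcoef (lval G) (v - zvec u).
  move=> du; rewrite -[in LHS](v'_sub i v) phiE; last by rewrite mdegD mdeg1 du.
  by rewrite thetaE -(eval_entry_old _ j k F _ m).
exists phi; split.
- move=> G; apply: laurentP => z; rewrite lcoefZ /Pmap /= addrK.
  have -> : (l + 1).-1 = l by rewrite addn1.
  rewrite lcoef_restrict ?uniq_Dpts //; case: ifPn => [/mapP[u]|zS].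
    by rewrite mem_Dexp => /eqP du ->; rewrite old // rmorphD.
  by rewrite (supportedP _ _ (valP G)) ?mulr0.
- move=> _ G GE s h ds.
  set p := map_poly (@FracField.tofrac R) (edge_poly j k d F).
  have sp : (size p <= d.+1)%N by apply: leq_trans (size_poly _ _) (size_poly _ _).
  have pE n : (n <= d)%N -> p`_n = FracField.tofrac F@_(edge_mnm j k n (d - n)).
    by move=> nd; rewrite coef_map coef_edge_poly.
  (* What remains is the scaling of the old coefficients and the Sylvester system for the new
     ones. *)
  apply: (extension_espace Hijk d_gt0 (a := fun t => FracField.tofrac F@_t) sp pE
    (g := lcoef (lval G)) (g' := lcoef (lval (phi G))) (theta := theta)) => //.
    exact: old.
  move=> r; rewrite thetaE -(eval_entry_new F Hijk) //; apply: eq_bigr => c _.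
  by rewrite phiE // (mdeg_edge Hijk) /l; have := ltn_ord c; lia.
- move=> r c G.
  have mem_nth_Dexp l' n q : (n < q)%N -> 'C(l'.+2, 2) = q ->
      mdeg (nth 0%MM (Dexp l') n) = l'.
    by move=> nq lq; apply/eqP; rewrite -mem_Dexp mem_nth // size_Dexp lq.
  set u := nth _ _ r; set w := nth _ _ c.
  have du : mdeg u = (l + 1)%N.
    by apply: mem_nth_Dexp (ltn_ord r) _; congr 'C(_, 2); rewrite /l; lia.
  have dw : mdeg w = l.
    by apply: mem_nth_Dexp (ltn_ord c) _; congr 'C(_, 2); rewrite /l; lia.
  move=> GE; rewrite phiE // GE !mxE (bigD1_seq w) ?uniq_Dexp ?mem_Dexp ?dw //=.
  rewrite lcoef_lmon eqxx mulr1 big1 ?addr0 // => x xw; rewrite lcoef_lmon.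
  case: eqP => [/addrI/oppr_inj/zvec_inj wE|_]; last exact: mulr0.
  by rewrite wE eqxx in xw.
Qed.
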